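(* For nonnegative integers $q$, $r$, and $n$, we have $$\sum_{k=l}^{n}\genfrac{[}{]}{0pt}{}{n+r}{k+r}_{r}k(k-1)\cdots(k-l+1)\,B_{k-l}(q)=n!\binom{n+q+r-1}{q+r-2}P(l+1,\,n+q+r-1,\,q+r-2),$$ where $l$ is a nonnegative integer.
   Context: The $r$-Stirling numbers of the first kind $\genfrac{[}{]}{0pt}{}{n+r}{k+r}_{r}$ are defined by $(x+r)(x+r+1)\cdots(x+r+n-1)=\sum_{k=0}^{n}\genfrac{[}{]}{0pt}{}{n+r}{k+r}_{r}x^{k}$. $B_k(x)$ are the Bernoulli polynomials, $\frac{te^{xt}}{e^t-1}=\sum_{k\ge0}B_k(x)\frac{t^k}{k!}$. For $l=0$ the product $k(k-1)\cdots(k-l+1)$ is $1$. A sum with $l>n$ is empty (equal to $0$). $H_n^{(s)}=\sum_{k=1}^n 1/k^s$ are the generalized harmonic numbers, with $H_0^{(s)}=0$. The quantity $P(s,m+k,m)$ is defined by $$P(s,m+k,m)=P_{s}\bigl(H_{m+k}^{(1)}-H_{m}^{(1)},\,H_{m+k}^{(2)}-H_{m}^{(2)},\ldots,H_{m+k}^{(s)}-H_{m}^{(s)}\bigr),$$ where the polynomials $P_s$ are given by $P_0=1$ and $$P_{s}(x_{1},\ldots,x_{s})=(-1)^{s}Y_{s}(-0!\,x_{1},-1!\,x_{2},\ldots,-(s-1)!\,x_{s}),$$ and $Y_s$ is the (complete) exponential Bell polynomial, $\exp\bigl(\sum_{j\ge1}y_j\frac{t^j}{j!}\bigr)=\sum_{s\ge0}Y_s(y_1,\ldots,y_s)\frac{t^s}{s!}$.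 For example $P_1=x_1$, $P_2=x_1^2-x_2$, $P_3=x_1^3-3x_1x_2+2x_3$.
   Formalization: The identity is stated for q + r ≥ 2; for the remaining pairs (q,r) = (0,0), (1,0), (0,1) the right-hand side involves harmonic numbers and a lower binomial index q + r − 2 that is negative, and is undefined. *)

(* Defs.v *)
From mathcomp Require Import all_boot all_order all_algebra.

Set Implicit Arguments.
Unset Strict Implicit.
Unset Printing Implicit Defensive.

Import GRing.Theory.
Local Open Scope ring_scope.

(* A formal power series \sum_n f_n t^n is represented by its coefficient
   sequence f : nat -> R. *)
Definition fps_mul (R : comUnitRingType) (f g : nat -> R) (n : nat) : R :=
  \sum_(i < n.+1) f i * g (n - i)%N.

Fixpoint fps_pow (R : comUnitRingType) (f : nat -> R) (m : nat) : nat -> R :=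
  if m is m'.+1 then fps_mul f (fps_pow f m') else fun n => (n == 0%N)%:R.

(* The composite \sum_m c_m g(t)^m, for g(0) = 0: then g^m has no term of
   degree < m, so the coefficient of t^n only involves m <= n. *)
Definition fps_comp (R : comUnitRingType) (c g : nat -> R) (n : nat) : R :=
  \sum_(m < n.+1) c m * fps_pow g m n.

(* The inverse of a series f with f(0) = 1, as the geometric series in 1 - f. *)
Definition fps_inv (R : comUnitRingType) (f : nat -> R) : nat -> R :=
  fps_comp (fun _ => 1) (fun n => (n == 0%N)%:R - f n).

(* e^{at} *)
Definition fps_exp (R : comUnitRingType) (a : R) (n : nat) : R :=
  a ^+ n / n`!%:R.

(* rstirling1 r n k is [n+r, k+r]_r. *)
Definition rstirling1 (r n k : nat) : rat :=
  (\prod_(i < n) ('X + (r + i)%:R%:P : {poly rat}))`_k.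

(* B_k(x) / k! is the coefficient of t^k in e^{xt} ((e^t - 1) / t)^{-1}, with
   x the indeterminate of {poly rat}. *)
Definition bernoulli_poly (k : nat) : {poly rat} :=
  k`!%:R * fps_mul (fps_exp 'X) (fps_inv (fun n => fps_exp 1 n.+1)) k.

(* Y_s(y 1, ..., y s); the value y 0 is not used. *)
Definition complete_bell (s : nat) (y : nat -> rat) : rat :=
  s`!%:R * fps_comp (fun m => m`!%:R^-1)
                    (fun j => if j is 0 then 0 else y j / j`!%:R) s.

(* P_s(x 1, ..., x s) *)
Definition Ppoly (s : nat) (x : nat -> rat) : rat :=
  (-1) ^+ s * complete_bell s (fun j => - (j.-1)`!%:R * x j).

(* H_n^{(s)} *)
Definition harmonic (s n : nat) : rat :=
  \sum_(1 <= k < n.+1) (k%:R ^+ s)^-1.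

(* Pharm s (m + k) m is P(s, m+k, m). *)
Definition Pharm (s M m : nat) : rat :=
  Ppoly s (fun j => harmonic j M - harmonic j m).

Section FpsFacts.
Variable R : comUnitRingType.
Implicit Types f g h : nat -> R.

Lemma fps_mulE f g n k : (k <= n)%N ->
  fps_mul f g k = (\poly_(i < n.+1) f i * \poly_(i < n.+1) g i)`_k.
Proof.
move=> le_kn; rewrite coefM; apply: eq_bigr => i _.
rewrite !coef_poly !ltnS (leq_trans (leq_subr _ _) le_kn).
by rewrite (leq_trans _ le_kn) // -ltnS.
Qed.

Lemma fps_mulA f g h n :
  fps_mul f (fps_mul g h) n = fps_mul (fps_mul f g) h n.
Proof.
pose T u := \poly_(i < n.+1) (u i : R).
transitivity ((T f * (T g * T h))`_n).
  rewrite coefM; apply: eq_bigr => i _.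
  by rewrite (@fps_mulE g h n) ?leq_subr // coef_poly ltn_ord.
rewrite mulrA coefM; apply: eq_bigr => i _.
rewrite (@fps_mulE f g n) ?leq_ord //.
by rewrite [(T h)`_ _]coef_poly ltnS leq_subr.
Qed.

Lemma fps_mulC f g n : fps_mul f g n = fps_mul g f n.
Proof. by rewrite !(@fps_mulE _ _ n) // mulrC. Qed.

Lemma fps_mul1 f n : fps_mul (fun i => (i == 0%N)%:R) f n = f n.
Proof.
rewrite /fps_mul big_ord_recl subn0 mul1r big1 ?addr0 // => i _.
by rewrite mul0r.
Qed.

Lemma fps_pow_small f m n : f 0%N = 0 -> (n < m)%N -> fps_pow f m n = 0.
Proof.
move=> f0; elim: m n => // m IHm n lt_nm /=.
rewrite /fps_mul big_ord_recl f0 mul0r add0r big1 // => i _.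
rewrite IHm ?mulr0 //; case: n i lt_nm => [[//]|n] i lt_nm.
by rewrite subSS (leq_ltn_trans (leq_subr _ _)).
Qed.

Lemma fps_mulV f n : f 0%N = 1 -> fps_mul f (fps_inv f) n = (n == 0%N)%:R.
Proof.
move=> f0; pose h i := (i == 0%N)%:R - f i.
have h0 : h 0%N = 0 by rewrite /h f0 subrr.
have compE i : (i <= n)%N ->
    fps_inv f i = \sum_(m < n.+1) fps_pow h m i.
  move=> le_in; rewrite /fps_inv /fps_comp.
  rewrite (eq_bigr (fun m : 'I_i.+1 => fps_pow h m i)); last first.
    by move=> m _; rewrite mul1r.
  rewrite -!(big_mkord xpredT (fun m => fps_pow h m i)).
  rewrite [RHS](@big_cat_nat _ _ _ i.+1) //= [X in _ + X]big_nat_cond.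
  by rewrite [X in _ + X]big1 ?addr0 // => m /andP[/andP[lt_im _] _];
     rewrite fps_pow_small.
have hE : fps_mul h (fps_inv f) n = fps_inv f n - (n == 0%N)%:R.
  rewrite /fps_mul.
  under eq_bigr => i _ do rewrite compE ?leq_subr // mulr_sumr.
  rewrite exchange_big /= (eq_bigr (fun m : 'I_n.+1 => fps_pow h m.+1 n)) //.
  apply/eqP; rewrite eq_sym subr_eq eq_sym addrC compE //.
  have : \sum_(m < n.+2) fps_pow h m n = \sum_(m < n.+1) fps_pow h m n.
    by rewrite big_ord_recr (fps_pow_small h0 (leqnn _)) /= addr0.
  by rewrite big_ord_recl => ->.
have -> : fps_mul f (fps_inv f) n
    = fps_mul (fun i => (i == 0%N)%:R) (fps_inv f) n - fps_mul h (fps_inv f) n.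
  rewrite -sumrB; apply: eq_bigr => i _.
  by rewrite -mulrBl /h opprB addrC subrK.
by rewrite fps_mul1 hE opprB addrC subrK.
Qed.

End FpsFacts.

(* (e^t - 1) \sum_k B_k(x) t^k / k! = t e^{xt} *)
Lemma bernoulli_poly_gf n :
  fps_mul (fun i => fps_exp 1 i - (i == 0%N)%:R)
          (fun k => bernoulli_poly k / k`!%:R) n
  = if n is m.+1 then fps_exp 'X m else 0.
Proof.
have fact_unit k : (k`!%:R : {poly rat}) \is a GRing.unit.
  rewrite -polyC_natr poly_unitE size_polyC coefC /= unitfE.
  by rewrite Num.Theory.pnatr_eq0 -lt0n fact_gt0.
rewrite /fps_mul big_ord_recl /= /fps_exp expr0 fact0 divr1 subrr mul0r add0r.
case: n => [|n]; first by rewrite big_ord0.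
pose D i : {poly rat} := fps_exp 1 i.+1.
have D0 : D 0%N = 1 by rewrite /D /fps_exp expr1 divr1.
transitivity (fps_mul D (fps_mul (fps_exp 'X) (fps_inv D)) n).
  apply: eq_bigr => i _; rewrite /= subr0 /bump /= add1n subSS.
  by rewrite /bernoulli_poly [_%:R * _]mulrC mulrK.
have -> : fps_mul D (fps_mul (fps_exp 'X) (fps_inv D)) n
    = fps_mul D (fps_mul (fps_inv D) (fps_exp 'X)) n.
  by apply: eq_bigr => i _; rewrite [in LHS]fps_mulC.
rewrite fps_mulA -[RHS](fps_mul1 (fps_exp 'X)).
by apply: eq_bigr => i _; rewrite fps_mulV.
Qed.

(* Main.v *)
Require Import Defs.
From mathcomp Require Import all_boot all_order all_algebra.
From mathcomp Require Import ring.

Set Implicit Arguments.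
Unset Strict Implicit.
Unset Printing Implicit Defensive.

Import GRing.Theory.
Local Open Scope ring_scope.

(* Let f = (X+r)...(X+r+n-1) and G = (X+r-1)(X+r)...(X+r+n-1), so that
   G(X+1) - G = (n+1) f.  The linear map X^k |-> B_k(X) sends p(X+1) - p to p'
   and commutes with differentiation, hence the left-hand side, which is the
   image of f^(l) evaluated at q, equals G^(l+1)(q) / (n+1).  With
   m = q + r - 2, Taylor expansion at q turns this into (l+1)! / (n+1) times
   the coefficient of X^(l+1) in the product of the X + (m+1+i), i <= n, i.e.
   an elementary symmetric function of the 1 / (m+1+i).  By Newton's
   identities s! e_s is P_s of the power sums, which here are differences of
   harmonic numbers. *)

(** * The Euler operator on formal power series *)

Section EulerOperator.
Variable R : comUnitRingType.
Implicit Types f g : nat -> R.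

(** The operator t d/dt; unlike d/dt it preserves degrees, so products need no index shift. *)
Definition fps_theta f (n : nat) : R := n%:R * f n.

Lemma fps_thetaM f g n :
  fps_theta (fps_mul f g) n
  = fps_mul (fps_theta f) g n + fps_mul f (fps_theta g) n.
Proof.
rewrite /fps_theta /fps_mul mulr_sumr -big_split /=; apply: eq_bigr => i _.
by rewrite -{1}(subnKC (leq_ord i)) natrD; ring.
Qed.

Lemma fps_theta_powS g m n :
  fps_theta (fps_pow g m.+1) n
  = m.+1%:R * fps_mul (fps_theta g) (fps_pow g m) n.
Proof.
elim: m n => [|m IHm] n; rewrite [fps_pow _ _]/= fps_thetaM.
  rewrite mul1r [X in _ + X]big1 ?addr0 // => i _.
  by rewrite /fps_theta; case: (n - i)%N => [|k]; rewrite ?mul0r !mulr0.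
have -> : fps_mul g (fps_theta (fps_mul g (fps_pow g m))) n
    = m.+1%:R * fps_mul g (fps_mul (fps_theta g) (fps_pow g m)) n.
  rewrite mulr_sumr; apply: eq_bigr => i _.
  by rewrite (IHm (n - i)%N) mulrCA.
rewrite [fps_mul g (fps_mul _ _) n]fps_mulA.
have -> : fps_mul (fps_mul g (fps_theta g)) (fps_pow g m) n
    = fps_mul (fps_mul (fps_theta g) g) (fps_pow g m) n.
  by apply: eq_bigr => i _; rewrite fps_mulC.
by rewrite -fps_mulA [m.+2%:R]mulrS mulrDl mul1r.
Qed.

End EulerOperator.

(** Chain rule for exp(g), taken termwise: the factor m + 1 from [fps_theta_powS] cancels against 1
    / (m + 1)!. *)
Lemma fps_theta_exp (R : numFieldType) (g : nat -> R) s : g 0%N = 0 ->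
  let E := fps_comp (fun m => m`!%:R^-1) g in
  fps_theta E s = fps_mul (fps_theta g) E s.
Proof.
move=> g0 E.
have EE k : (k < s)%N -> E k = \sum_(m < s) m`!%:R^-1 * fps_pow g m k.
  move=> lt_ks; rewrite /E /fps_comp.
  rewrite -!(big_mkord xpredT (fun m => m`!%:R^-1 * fps_pow g m k)).
  rewrite [RHS](@big_cat_nat _ _ _ k.+1) //= [X in _ + X]big_nat_cond.
  rewrite [X in _ + X]big1 ?addr0 // => m /andP[/andP[lt_km _] _].
  by rewrite fps_pow_small ?mulr0.
transitivity (\sum_(m < s) m`!%:R^-1 * fps_mul (fps_theta g) (fps_pow g m) s).
  rewrite /fps_theta /E /fps_comp mulr_sumr big_ord_recl /=.
  rewrite (_ : s%:R * _ = 0) ?add0r; last first.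
    by case: (s) => [|k]; rewrite ?mul0r ?mulr0.
  apply: eq_bigr => m _; rewrite /bump /= add1n mulrCA.
  rewrite [_ * fps_mul _ _ _](fps_theta_powS g m s) mulrA factS natrM invfM.
  by rewrite [_^-1 / _]mulrC mulrVK // unitfE Num.Theory.pnatr_eq0.
rewrite /fps_mul; under eq_bigr do rewrite mulr_sumr.
(* The term j = 0 would involve [E s], outside the range of [EE], but theta(g) has no constant
   term. *)
rewrite exchange_big /=; apply: eq_bigr => -[[|j] lt_j] _ /=.
  by rewrite /fps_theta !mul0r big1 // => m _; rewrite mul0r mulr0.
rewrite EE ?mulr_sumr; first by apply: eq_bigr => m _; rewrite mulrCA.
by rewrite ltn_subrL; exact: leq_ltn_trans (leq0n j) lt_j.
Qed.

(** * Newton's identities *)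

Section Newton.
Variables (R : comUnitRingType) (a : nat -> R).

Definition power_sum N (j : nat) : R := \sum_(i < N) a i ^+ j.

Lemma power_sumS N j : power_sum N.+1 j = power_sum N j + a N ^+ j.
Proof. by rewrite /power_sum big_ord_recr. Qed.

(** Its coefficients are the signed elementary symmetric functions (-1)^s e_s of the a_i. *)
Definition one_minus_prod N : {poly R} := \prod_(i < N) (1 - (a i)%:P * 'X).

Lemma one_minus_prodS N s :
  (one_minus_prod N.+1)`_s
  = (one_minus_prod N)`_s
    - a N * (if s is k.+1 then (one_minus_prod N)`_k else 0).
Proof.
rewrite /one_minus_prod big_ord_recr /= mulrC mulrBl mul1r coefB -mulrA coefCM.
by rewrite coefXM; case: s.
Qed.

Lemma one_minus_prod0 N : (one_minus_prod N)`_0 = 1.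
Proof.
elim: N => [|N IHN]; first by rewrite /one_minus_prod big_ord0 coef1.
by rewrite one_minus_prodS IHN mulr0 subr0.
Qed.

(** Division by the last factor 1 - a_N X, expanded as a geometric series. *)
Lemma geometric_one_minus_prod N s :
  \sum_(j < s.+1) a N ^+ j * (one_minus_prod N.+1)`_(s - j)
  = (one_minus_prod N)`_s.
Proof.
elim: s => [|s IHs]; first by rewrite big_ord1 mul1r !one_minus_prod0.
rewrite big_ord_recl mul1r subn0 one_minus_prodS -IHs mulr_sumr.
rewrite addrAC -addrA -sumrB big1 ?addr0 // => i _.
by rewrite lift0 subSS exprS mulrA subrr.
Qed.

(** Induction on N: the powers contributed by the new a_N form a geometric series, which collapses
    to a coefficient of the shorter product. *)
Lemma newton_identity N s :
  s.+1%:R * (one_minus_prod N)`_s.+1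
  = - \sum_(j < s.+1) power_sum N j.+1 * (one_minus_prod N)`_(s - j).
Proof.
elim: N s => [|N IHN] s.
  rewrite /one_minus_prod big_ord0 coef1 mulr0 big1 ?oppr0 // => j _.
  by rewrite /power_sum big_ord0 mul0r.
under eq_bigr do rewrite power_sumS mulrDl.
rewrite big_split /=.
under [X in _ + X]eq_bigr do rewrite exprS -mulrA.
rewrite -mulr_sumr geometric_one_minus_prod.
under eq_bigr do rewrite one_minus_prodS mulrBr.
rewrite sumrB opprD opprB addrC [_ - \sum_(_ < _) _]addrC -IHN.
rewrite one_minus_prodS mulrBr addrCA; congr (_ + _).
(* What remains is a_N times the induction hypothesis one degree lower, which exists only for
   positive s. *)
case: s => [|s]; first by rewrite big_ord1 !mulr0 addr0 !mul1r.
rewrite big_ord_recr /= subnn !mulr0 addr0.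
rewrite (eq_bigr (fun j : 'I_s.+1 =>
    a N * (power_sum N j.+1 * (one_minus_prod N)`_(s - j)))); last first.
  by move=> j _; rewrite subSn ?leq_ord // mulrCA.
rewrite -mulr_sumr -[\sum_(_ < _) _]opprK -IHN.
by rewrite [s.+2%:R]mulrS; ring.
Qed.

End Newton.

(** * Power sums and the polynomials P_s *)

(** Since h has no constant term, each equation gives (s+1) times the coefficient of degree s+1 in
    terms of lower ones, and s+1 is invertible. *)
Lemma fps_theta_unique (R : numFieldType) (h f g : nat -> R) :
  h 0%N = 0 -> f 0%N = g 0%N ->
  (forall s, fps_theta f s = fps_mul h f s) ->
  (forall s, fps_theta g s = fps_mul h g s) ->
  f =1 g.
Proof.
move=> h0 fg0 Hf Hg s; have [n] := ubnP s.
elim: n s => // n IHn [//|s] lt_sn.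
apply: (@mulfI R s.+1%:R); first by rewrite Num.Theory.pnatr_eq0.
transitivity (fps_mul h f s.+1); first exact: Hf.
transitivity (fps_mul h g s.+1); last exact/esym/Hg.
rewrite /fps_mul big_ord_recl [RHS]big_ord_recl h0 !mul0r; congr (_ + _).
apply: eq_bigr => i _; rewrite IHn // lift0 subSS.
by rewrite (leq_ltn_trans (leq_subr _ _)) -1?ltnS.
Qed.

Lemma coef_one_minus_prod (R : comUnitRingType) (a : nat -> R) N s :
  (-1) ^+ s * (one_minus_prod a N)`_s
  = (\prod_(i < N) (1 + (a i)%:P * 'X))`_s.
Proof.
elim: N s => [|N IHN] s.
  rewrite /one_minus_prod !big_ord0 coef1.
  by case: s => [|s]; rewrite ?mulr0 // mul1r.
rewrite one_minus_prodS big_ord_recr /= [in RHS]mulrDr mulr1 coefD.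
rewrite [in RHS]mulrCA coefCM coefMX -IHN.
case: s => [|s] /=; first by rewrite !mulr0 subr0 addr0.
by rewrite -IHN !exprS; ring.
Qed.

(** With p_j the power sums, exp(- sum_j p_j t^j / j) and the product of the 1 - a_i t have constant
    term 1 and solve the same Euler equation, the latter by Newton. The sign (-1)^s then replaces t
    by -t. *)
Lemma Ppoly_power_sum (a : nat -> rat) N s (x : nat -> rat) :
  (forall j, (0 < j)%N -> x j = power_sum a N j) ->
  Ppoly s x = s`!%:R * (\prod_(i < N) (1 + (a i)%:P * 'X))`_s.
Proof.
move=> xE; rewrite /Ppoly /complete_bell -coef_one_minus_prod mulrCA.
congr (_ * (_ * _)).
set g := (X in fps_comp _ X).
have g0 : g 0%N = 0 by [].
have thgE j : fps_theta g j.+1 = - power_sum a N j.+1.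
  rewrite /fps_theta /g /= xE // factS natrM.
  have f1 : (j`!%:R : rat) != 0 by rewrite Num.Theory.pnatr_eq0 -lt0n fact_gt0.
  have f2 : (j.+1%:R : rat) != 0 by rewrite Num.Theory.pnatr_eq0.
  by field; rewrite -mulrS f1 f2.
apply: (@fps_theta_unique _ (fps_theta g)).
- by rewrite /fps_theta mul0r.
- by rewrite /fps_comp big_ord1 invr1 mul1r one_minus_prod0.
- by move=> k; apply: fps_theta_exp.
move=> [|k]; first by rewrite /fps_mul big_ord1 /fps_theta !mul0r.
rewrite /fps_mul big_ord_recl {2}/fps_theta !mul0r add0r.
rewrite {1}/fps_theta newton_identity -sumrN; apply: eq_bigr => i _.
by rewrite lift0 thgE subSS mulNr.
Qed.

(** * The Bernoulli map and finite differences *)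

(** This is (n+1)! times the coefficient of t^(n+1) in [bernoulli_poly_gf]. *)
Lemma bernoulli_poly_shift (n : nat) (x : rat) :
  \sum_(i < n.+1) 'C(n.+1, i)%:R * (bernoulli_poly i).[x] = n.+1%:R * x ^+ n.
Proof.
have fN0 k : (k`!%:R : rat) != 0 by rewrite Num.Theory.pnatr_eq0 -lt0n fact_gt0.
have expE (p : {poly rat}) k : (p / k`!%:R).[x] = p.[x] / k`!%:R.
  by rewrite -polyC_natr polyCV hornerM hornerC.
have := congr1 (fun p => n.+1`!%:R * p.[x]) (bernoulli_poly_gf n.+1).
rewrite /fps_exp /= expE horner_exp hornerX factS natrM mulrACA divff // mulr1.
move=> <-; rewrite -natrM -factS /fps_mul [in RHS]big_ord_recl /= expr0 fact0 divr1.
rewrite subrr mul0r add0r horner_sum mulr_sumr (reindex_inj rev_ord_inj) /=.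
apply: eq_bigr => i _; rewrite /bump /= add1n !subSS subr0.
rewrite [in RHS]hornerM !expE expr1n hornerC -(@bin_fact n.+1 (n - i)); last first.
  exact: leq_trans (leq_subr _ _) _.
rewrite subSn ?leq_subr // subKn ?leq_ord // 2!natrM.
have := fN0 (n - i)%N; have := fN0 i.+1.
move: (i.+1)`!%:R (n - i)`!%:R => u v u0 v0.
by field; rewrite u0 v0.
Qed.

(** A cutoff N independent of p keeps the map visibly linear; it is harmless once N bounds the size
    of p. *)
Definition bernoulli_map (x : rat) (N : nat) (p : {poly rat}) : rat :=
  \sum_(k < N) p`_k * (bernoulli_poly k).[x].

Lemma bernoulli_mapB x N p p' :
  bernoulli_map x N (p - p') = bernoulli_map x N p - bernoulli_map x N p'.
Proof.
by rewrite /bernoulli_map -sumrB; apply: eq_bigr => k _; rewrite coefB mulrBl.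
Qed.

Lemma bernoulli_map_sum x N n (c : nat -> rat) (p : nat -> {poly rat}) :
  bernoulli_map x N (\sum_(i < n) c i *: p i)
  = \sum_(i < n) c i * bernoulli_map x N (p i).
Proof.
rewrite /bernoulli_map; under [RHS]eq_bigr do rewrite mulr_sumr.
rewrite exchange_big; apply: eq_bigr => k _ /=.
by rewrite coef_sum mulr_suml; apply: eq_bigr => i _; rewrite coefZ mulrA.
Qed.

(** By linearity p is a monomial X^i; the leading term of (X+1)^i - X^i cancels and
    [bernoulli_poly_shift] sums the rest. *)
Lemma bernoulli_map_diff x N (p : {poly rat}) : (size p <= N)%N ->
  bernoulli_map x N (p \Po ('X + 1) - p) = p^`().[x].
Proof.
move=> le_pN.
have -> : p \Po ('X + 1) - p
    = \sum_(i < size p) p`_i *: (('X + 1) ^+ i - 'X^i).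
  rewrite comp_polyE -[X in _ - X]coefK poly_def -sumrB.
  by apply: eq_bigr => i _; rewrite scalerBr.
rewrite (bernoulli_map_sum _ _ _ (fun i => p`_i) (fun i => ('X + 1) ^+ i - 'X^i)).
rewrite -[X in X^`()]coefK poly_def raddf_sum horner_sum /=.
apply: eq_bigr => -[i lt_ip] _ /=.
rewrite derivZ hornerZ derivXn hornerMn hornerXn; congr (_ * _).
rewrite exprD1n big_ord_recr /= binn mulr1n addrK.
case: i lt_ip => [|i] lt_ip.
  by rewrite /bernoulli_map big_ord0 big1 // => k _; rewrite coef0 mul0r.
rewrite -mulr_natl -bernoulli_poly_shift /bernoulli_map.
have lt_iN : (i.+1 <= N)%N by apply: leq_trans le_pN; exact: ltnW.
rewrite (big_ord_widen N (fun k => 'C(i.+1, k)%:R * (bernoulli_poly k).[x])) //.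
rewrite [RHS]big_mkcond; apply: eq_bigr => k _ /=.
rewrite coef_sum; case: ifP => [lt_ki | ge_ki].
  rewrite (bigD1 (Ordinal lt_ki)) //= coefMn coefXn eqxx big1 ?addr0 // => j neq_j.
  by rewrite coefMn coefXn eq_sym -[_ == _]/(j == Ordinal lt_ki) (negPf neq_j) mul0rn.
rewrite big1 ?mul0r // => j _; rewrite coefMn coefXn.
case: eqP => [kj|]; last by rewrite mul0rn.
by have := ltn_ord j; rewrite -kj ge_ki.
Qed.

(** * Taylor shifts and products of linear factors *)

Lemma derivn_comp_addC (R : comNzRingType) (p : {poly R}) (c : R) n :
  (p \Po ('X + c%:P))^`(n) = p^`(n) \Po ('X + c%:P).
Proof.
elim: n => // n IHn.
by rewrite derivnS IHn deriv_comp derivD derivX derivC addr0 mulr1.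
Qed.

(** Taylor's formula, read off the constant term of the n-th derivative of p(X + c). *)
Lemma horner_derivn (R : comNzRingType) (p : {poly R}) (c : R) n :
  p^`(n).[c] = n`!%:R * (p \Po ('X + c%:P))`_n.
Proof.
have := congr1 (fun u : {poly R} => u`_0) (derivn_comp_addC p c n).
rewrite coef_derivn addn0 ffactnn mulr_natl => ->.
by rewrite -horner_coef0 horner_comp hornerD hornerX hornerC add0r.
Qed.

Lemma comp_prod_XaddC (R : comNzRingType) n (c : nat -> R) (d : R) :
  (\prod_(i < n) ('X + (c i)%:P)) \Po ('X + d%:P)
  = \prod_(i < n) ('X + (c i + d)%:P).
Proof.
rewrite rmorph_prod /=; apply: eq_bigr => i _.
by rewrite comp_polyD comp_polyX comp_polyC -addrA -polyCD [d + _]addrC.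
Qed.

(** G(X+1) and G share n factors; the remaining ones, X + r + n and X + r - 1, differ by n + 1. The
    1 is subtracted in [rat] because r may be 0. *)
Lemma prod_shift_antidiff (r n : nat) :
  let G : {poly rat} := \prod_(i < n.+1) ('X + ((r + i)%:R - 1)%:P) in
  G \Po ('X + 1) - G = n.+1%:R *: \prod_(i < n) ('X + (r + i)%:R%:P).
Proof.
move=> G; rewrite [G \Po _](comp_prod_XaddC _ (fun i => (r + i)%:R - 1) 1).
under eq_bigr do rewrite subrK.
rewrite /G big_ord_recl big_ord_recr /=.
under [in X in _ - X]eq_bigr do rewrite /bump /= add1n addnS -addn1 natrD addrK.
rewrite mulrC -mulrBl -mul_polyC; congr (_ * _).
rewrite [X in X - _]addrC addrKA -polyCB; congr _%:P.
by rewrite addn0 natrD -natr1; ring.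
Qed.

(** * Harmonic numbers, factorials and the final computation *)

Lemma harmonic_diff j m N :
  harmonic j (m + N) - harmonic j m
  = power_sum (fun i => (m + i.+1)%:R^-1) N j.
Proof.
elim: N => [|N IHN]; first by rewrite addn0 subrr /power_sum big_ord0.
rewrite power_sumS -IHN addnS.
by rewrite /harmonic big_nat_recr //= exprVn addrAC.
Qed.

Lemma fact_mul_prod m N :
  m`!%:R * \prod_(i < N) (m + i.+1)%:R = (m + N)`!%:R :> rat.
Proof.
elim: N => [|N IHN]; first by rewrite big_ord0 mulr1 addn0.
by rewrite big_ord_recr /= mulrA IHN addnS factS natrM mulrC.
Qed.

Lemma prod_XaddC_scale (F : fieldType) N (b : nat -> F) :
  (forall i, b i != 0) ->
  \prod_(i < N) ('X + (b i)%:P)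
  = (\prod_(i < N) b i) *: \prod_(i < N) (1 + (b i)^-1%:P * 'X).
Proof.
move=> bN0; rewrite -mul_polyC rmorph_prod -big_split /=.
apply: eq_bigr => i _.
by rewrite mulrDr mulr1 mulrA -polyCM divff // mul1r addrC.
Qed.

(** After the shift k = j + l, the falling factorials are those of the l-th derivative. N stays free
    so that it can also meet the size bound of [bernoulli_map_diff]. *)
Lemma sum_rstirling1_bernoulli (q : rat) (r n l N : nat) : (n.+1 <= N)%N ->
  \sum_(l <= k < n.+1)
     rstirling1 r n k * (k ^_ l)%:R * (bernoulli_poly (k - l)).[q]
  = bernoulli_map q N (\prod_(i < n) ('X + (r + i)%:R%:P))^`(l).
Proof.
move=> lt_nN; rewrite -{1}[l]add0n big_addn /bernoulli_map.
set f := \prod_(i < n) _.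
have sz_f : (size f <= n.+1)%N.
  apply: leq_trans (size_prod_leq _ _) _.
  under eq_bigr do rewrite size_XaddC.
  by rewrite sum_nat_const card_ord muln2 -addnn -addnS addKn.
rewrite -(big_mkord xpredT (fun k => f^`(l)`_k * (bernoulli_poly k).[q])).
rewrite [RHS](@big_cat_nat _ _ _ (n.+1 - l)) //=; last first.
  exact: leq_trans (leq_subr _ _) lt_nN.
rewrite [X in _ + X]big_nat_cond [X in _ + X]big1 ?addr0; last first.
  move=> k /andP[/andP[le_k _] _]; rewrite coef_derivn nth_default ?mul0rn ?mul0r //.
  by apply: leq_trans sz_f _; rewrite -leq_subLR.
by apply: eq_bigr => k _; rewrite coef_derivn addnK mulr_natr addnC.
Qed.

Theorem theorem6 (q r n l : nat) (hqr : (2 <= q + r)%N) :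
  \sum_(l <= k < n.+1)
     rstirling1 r n k * (k ^_ l)%:R * (bernoulli_poly (k - l)).[q%:R]
  = n`!%:R * 'C(n + q + r - 1, q + r - 2)%:R
    * Pharm l.+1 (n + q + r - 1) (q + r - 2).
Proof.
(* By [hqr] the truncated subtraction is exact. *)
set m := (q + r - 2)%N; have qrE : (q + r)%N = m.+2 by rewrite -addn2 subnK.
have -> : (n + q + r - 1)%N = (m + n.+1)%N.
  by rewrite -addnA qrE !addnS subn1 addnC.
pose G : {poly rat} := \prod_(i < n.+1) ('X + ((r + i)%:R - 1)%:P).
pose A := n.+1%:R^-1 *: G; pose N := maxn n.+1 (size A^`(l)).
have nN0 : (n.+1%:R : rat) != 0 by rewrite Num.Theory.pnatr_eq0.
rewrite (@sum_rstirling1_bernoulli _ _ _ _ N) ?leq_maxl //.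
have -> : \prod_(i < n) ('X + (r + i)%:R%:P) = A \Po ('X + 1%:P) - A.
  by rewrite comp_polyZ -scalerBr prod_shift_antidiff scalerA mulVf // scale1r.
(* Differentiation commutes with the shift, so the sum is the derivative of order l + 1 of [A] at
   q. *)
rewrite derivnB derivn_comp_addC bernoulli_map_diff ?leq_maxr // -derivnS.
rewrite horner_derivn comp_polyZ coefZ.
rewrite (comp_prod_XaddC _ (fun i => (r + i)%:R - 1)).
have -> : \prod_(i < n.+1) ('X + ((r + i)%:R - 1 + q%:R)%:P)
    = \prod_(i < n.+1) ('X + (m + i.+1)%:R%:P) :> {poly rat}.
  apply: eq_bigr => i _; congr (_ + _%:P).
  rewrite addrAC -natrD addnAC [(r + q)%N]addnC qrE.
  by rewrite addSn -natr1 addrK addSnnS.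
rewrite (prod_XaddC_scale _ (b := fun i => (m + i.+1)%:R)); last first.
  by move=> i; rewrite Num.Theory.pnatr_eq0 addnS.
rewrite coefZ /Pharm.
rewrite (@Ppoly_power_sum (fun i => (m + i.+1)%:R^-1) n.+1); last first.
  by move=> j _; apply: harmonic_diff.
(* The extracted constant (m+1)...(m+n+1) is the binomial times (n+1)!; the factor 1/(n+1) in [A]
   leaves n!. *)
have /(congr1 (fun k => k%:R : rat)) := bin_fact (leq_addr n.+1 m).
rewrite -fact_mul_prod addKn factS !natrM => binE.
have mN0 : (m`!%:R : rat) != 0 by rewrite Num.Theory.pnatr_eq0 -lt0n fact_gt0.
have -> : \prod_(i < n.+1) (m + i.+1)%:R
    = 'C(m + n.+1, m)%:R * (n.+1%:R * n`!%:R) :> rat.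
  by apply: (mulfI mN0); rewrite -binE mulrCA.
by field; rewrite -mulrS nN0.
Qed.
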